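(* Let $\mathbb F$ be a division ring and let $p\in\mathbb F[z]$ be monic of degree $n$. The formula $$\varphi:\ \mathbf v\mapsto\mathfrak P_{C_\ell(p),\mathbf v}$$ defines a map from the set of all (right) cyclic vectors of the companion matrix $C_\ell(p)$ onto the similarity class of $p$. Moreover, for cyclic vectors $\mathbf v,\mathbf v'$ of $C_\ell(p)$, $\varphi(\mathbf v)=\varphi(\mathbf v')$ if and only if there exists an invertible $T\in\mathbb F^{n\times n}$ such that $$TC_\ell(p)=C_\ell(p)T\quad\text{and}\quad\mathbf v'=T\mathbf v.$$
   Context: $\mathbb F[z]$ is the ring of polynomials over $\mathbb F$ in a formal variable $z$ commuting with the coefficients; $n\ge1$. For monic $p(z)=z^n+\sum_{k=0}^{n-1}p_kz^k$, the left companion matrix is $C_\ell(p)=[\mathbf e_2\ \cdots\ \mathbf e_n\ \ -\mathbf p]\in\mathbb F^{n\times n}$, $\mathbf p=[p_0\ \cdots\ p_{n-1}]^\top$, with $\mathbf e_j$ the $j$-th column of $\mathbf I_n$. A vector $\mathbf v\in\mathbb F^{n\times1}$ is a (right) cyclic vector of $A\in\mathbb F^{n\times n}$ if $[\mathbf v\ A\mathbf v\ \cdots\ A^{n-1}\mathbf v]$ is invertible. $\mathfrak P_{A,\mathbf v}$ is the monic generator of the right ideal $\{q=\sum q_jz^j\in\mathbb F[z]:\sum_jA^j\mathbf vq_j=0\}$. Monic polynomials $f,g\in\mathbb F[z]$ are similar ($f\approx g$) if $C_\ell(f)$ and $C_\ell(g)$ are similar matrices over $\mathbb F$; the similarity class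 of $p$ is the set of all monic $g$ with $g\approx p$. *)

(* Defs.v *)
From HB Require Import structures.
From mathcomp Require Import all_boot all_order all_algebra.
From mathcomp Require Import boolp classical_sets functions.
From mathcomp Require Import zify.

Set Implicit Arguments.
Unset Strict Implicit.
Unset Printing Implicit Defensive.

Import GRing.Theory.
Local Open Scope classical_set_scope.
Local Open Scope ring_scope.

(* The unit predicate and the inverse of a [unitRingType] are two-sided, and
   multiplication is not assumed to be commutative. *)
Definition division_ring (F : unitRingType) : Prop :=
  forall x : F, x != 0 -> x \is a GRing.unit.

(* [unitmx] needs commutative coefficients. *)
Definition mx_invertible (F : nzRingType) (n : nat) (A : 'M[F]_n) : Prop :=
  exists B : 'M[F]_n, A *m B = 1%:M /\ B *m A = 1%:M.

Definition mx_similar (F : nzRingType) (n : nat) (A B : 'M[F]_n) : Prop :=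
  exists2 S : 'M[F]_n, mx_invertible S & S *m A = B *m S.

(* Columns e_2, ..., e_n, -(p_0, ..., p_(n-1))^T; meant for p monic with
   size p = n.+1. *)
Definition lcompanion (F : nzRingType) (n : nat) (p : {poly F}) : 'M[F]_n :=
  \matrix_(i < n, j < n)
    if j.+1 == n then - p`_i else (i == j.+1 :> nat)%:R.

Lemma lcompanion_companionmx (F : nzRingType) (p : {poly F}) :
  lcompanion (size p).-1 p = (companionmx p)^T.
Proof.
apply/matrixP => i j; rewrite !mxE [j.+1 == i]eq_sym.
suff -> : (j.+1 == (size p).-1) = (j == (size p).-2 :> nat) by [].
by move: (nat_of_ord j) (ltn_ord j) => k; case: ((size p).-1).
Qed.

Definition cyclic_vector (F : nzRingType) (n : nat)
    (A : 'M[F]_n) (v : 'cV[F]_n) : Prop :=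
  mx_invertible (\matrix_(i < n, j < n) (A ^+ j *m v) i 0).

(* The coefficients act on column vectors from the right, hence the 1 x 1
   matrix instead of the left scaling [*:]. *)
Definition right_annihilator (F : nzRingType) (n : nat)
    (A : 'M[F]_n) (v : 'cV[F]_n) : set {poly F} :=
  [set q : {poly F} | \sum_(j < size q) A ^+ j *m v *m (q`_j)%:M = 0].

Definition monic_generator (F : nzRingType) (I : set {poly F}) (P : {poly F})
    : Prop :=
  P \is monic /\ I = [set P * h | h in [set: {poly F}]].

Lemma monic_generator_unique (F : nzRingType) (I : set {poly F})
    (P Q : {poly F}) :
  monic_generator I P -> monic_generator I Q -> P = Q.
Proof.
move=> [Pmon IP] [Qmon IQ].
have [h _ Qh] : [set P * h | h in [set: {poly F}]] Q.
  by rewrite -IP IQ; exists 1; rewrite ?mulr1.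
have [k _ Pk] : [set Q * h | h in [set: {poly F}]] P.
  by rewrite -IQ IP; exists 1; rewrite ?mulr1.
have hmon : h \is monic by rewrite -(monicMl _ Pmon) Qh.
have kmon : k \is monic by rewrite -(monicMl _ Qmon) Pk.
have h_gt0 := monic_neq0 hmon; have k_gt0 := monic_neq0 kmon.
have P_gt0 := monic_neq0 Pmon; have Q_gt0 := monic_neq0 Qmon.
rewrite -!size_poly_gt0 in h_gt0 k_gt0 P_gt0 Q_gt0.
have szQ : size Q = (size P + size h).-1.
  by rewrite -Qh size_monicM // -size_poly_gt0.
have szP : size P = (size Q + size k).-1.
  by rewrite -[in LHS]Pk size_monicM // -size_poly_gt0.
have h1 : (size h <= 1)%N by lia.
move: hmon; rewrite (size1_polyC h1) monicE lead_coefC => /eqP h0.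
by rewrite -Qh (size1_polyC h1) h0 mulr1.
Qed.

(* The default value 0 is not monic, so it is never a monic generator. *)
Definition vminpoly (F : nzRingType) (n : nat)
    (A : 'M[F]_n) (v : 'cV[F]_n) : {poly F} :=
  xget 0 [set P | monic_generator (right_annihilator A v) P].

Definition poly_similar (F : nzRingType) (f g : {poly F}) : Prop :=
  exists n : nat, [/\ size f = n.+1, size g = n.+1 &
    mx_similar (lcompanion n f) (lcompanion n g)].

Definition similarity_class (F : nzRingType) (p : {poly F}) : set {poly F} :=
  [set g | g \is monic /\ poly_similar g p].

(* Main.v *)
(** If [v] is a cyclic vector of [A] and [K = [v, A v, ..., A^(n-1) v]], then a
    monic [P] of degree [n] generates the annihilator of [v] exactly when
    [A K = K C(P)]: the last column of this equation says that [P] annihilates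
    [v], and Euclidean division by [P] together with the invertibility of [K]
    gives the rest.  Hence [C(phi v)] is [K^-1 C(p) K].  Conversely, if
    [S C(g) = C(p) S] with [S] invertible, then [S] is the matrix [K] of its own
    first column, so [phi] maps that column to [g].  When [phi v = phi v'], the
    matrix [K' K^-1] commutes with [C(p)] and sends [v] to [v']. *)
Require Import Defs.
From HB Require Import structures.
From mathcomp Require Import all_boot all_order all_algebra.
From mathcomp Require Import boolp classical_sets functions.
Set Implicit Arguments.
Unset Strict Implicit.
Unset Printing Implicit Defensive.
Import GRing.Theory.
Local Open Scope classical_set_scope.
Local Open Scope ring_scope.

Lemma col_matrixP (R : Type) m n (A B : 'M[R]_(m, n)) :
  (forall j, col j A = col j B) <-> A = B.
Proof.
split=> [eqAB|-> //]; apply/matrixP => i j.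
by have /colP/(_ i) := eqAB j; rewrite !mxE.
Qed.

Lemma col_mulmx (R : nzRingType) m n k (j : 'I_k)
    (A : 'M[R]_(m, n)) (B : 'M[R]_(n, k)) :
  col j (A *m B) = A *m col j B.
Proof. by rewrite !colE mulmxA. Qed.

Section Invertible.
Variables (F : nzRingType) (n : nat).
Implicit Types A B : 'M[F]_n.

Lemma mx_invertibleM A B :
  mx_invertible A -> mx_invertible B -> mx_invertible (A *m B).
Proof.
move=> [A' [AA' A'A]] [B' [BB' B'B]]; exists (B' *m A'); split.
  by rewrite mulmxA -(mulmxA A) BB' mulmx1.
by rewrite mulmxA -(mulmxA B') A'A mulmx1.
Qed.

Lemma mx_invertible_mulmxI m A :
  mx_invertible A -> injective (mulmx A : 'M_(n, m) -> 'M_(n, m)).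
Proof.
by move=> [B [_ BA]] X Y /(congr1 (mulmx B)); rewrite !mulmxA BA !mul1mx.
Qed.

End Invertible.

Section Krylov.
Variables (F : nzRingType) (n : nat).
Implicit Types (A B T : 'M[F]_n) (v : 'cV[F]_n) (P q : {poly F}).

(** Literally the matrix inside [cyclic_vector], so [cyclic_vector A v] is by conversion the
    invertibility of [krylov A v]. *)
Definition krylov A v : 'M[F]_n := \matrix_(i < n, j < n) (A ^+ j *m v) i 0.

Lemma col_krylov A v (j : 'I_n) : col j (krylov A v) = A ^+ j *m v.
Proof. by apply/colP => i; rewrite !mxE. Qed.

(** An intertwiner of [A] and [B] also intertwines their powers. This serves both similarities ([A]
    and [B] different) and the commutant ([A = B]). *)
Lemma krylov_mul A B T v :
  T *m A = B *m T -> krylov B (T *m v) = T *m krylov A v.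
Proof.
move=> TA; have TX k : T *m A ^+ k = B ^+ k *m T.
  elim: k => [|k IHk]; first by rewrite !expr0 mulmx1 mul1mx.
  by rewrite !exprSr mulmxA IHk -!mulmxA TA.
by apply/col_matrixP => j; rewrite col_mulmx !col_krylov !mulmxA TX.
Qed.

(** The sum in [right_annihilator], i.e. the evaluation of [q] at [A] on [v] with coefficients
    acting from the right. *)
Definition vhorner A v q : 'cV[F]_n :=
  \sum_(j < size q) A ^+ j *m v *m (q`_j)%:M.

Lemma vhorner_wide A v q m :
  (size q <= m)%N -> vhorner A v q = \sum_(j < m) A ^+ j *m v *m (q`_j)%:M.
Proof.
move=> le_qm; rewrite /vhorner.
rewrite (big_ord_widen m (fun j => A ^+ j *m v *m (q`_j)%:M)) //.
rewrite big_mkcond; apply: eq_bigr => j _; case: ltnP => // le_qj.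
by rewrite nth_default // raddf0 mulmx0.
Qed.

Lemma vhornerD A v q r : vhorner A v (q + r) = vhorner A v q + vhorner A v r.
Proof.
pose m := maxn (size q) (size r).
rewrite !(@vhorner_wide _ _ _ m) ?leq_maxl ?leq_maxr ?size_polyD //.
rewrite -big_split; apply: eq_bigr => j _ /=.
by rewrite coefD raddfD mulmxDr.
Qed.

Lemma vhornerMC A v q c : vhorner A v (q * c%:P) = vhorner A v q *m c%:M.
Proof.
rewrite (@vhorner_wide _ _ _ (size q)); last first.
  by apply/leq_sizeP => j le_qj; rewrite coefMC nth_default ?mul0r.
rewrite /vhorner mulmx_suml; apply: eq_bigr => j _.
by rewrite coefMC scalar_mxM !mulmxA.
Qed.

Lemma vhornerMX A v q : vhorner A v (q * 'X) = A *m vhorner A v q.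
Proof.
rewrite (@vhorner_wide _ _ _ (size q).+1); last first.
  by apply/leq_sizeP => -[//|j] le_qj; rewrite coefMX nth_default.
rewrite big_ord_recl coefMX raddf0 mulmx0 add0r /vhorner mulmx_sumr.
by apply: eq_bigr => j _; rewrite coefMX exprS !mulmxA.
Qed.

(** By Horner decomposition of [q], only right factors ['X] and constants matter: the former act as
    [A] on the left, the latter as scalar matrices on the right, and both preserve 0. *)
Lemma vhornerM_eq0 A v P q : vhorner A v P = 0 -> vhorner A v (P * q) = 0.
Proof.
move=> P0; elim/poly_ind: q => [|q c IHq].
  by rewrite mulr0 /vhorner size_poly0 big_ord0.
by rewrite mulrDr mulrA vhornerD vhornerMX vhornerMC IHq P0 mulmx0 mul0mx addr0.
Qed.

Lemma vhorner_krylov A v q : (size q <= n)%N ->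
  vhorner A v q = krylov A v *m \col_i q`_i.
Proof.
move=> le_qn; rewrite (vhorner_wide _ _ le_qn); apply/colP => i.
rewrite summxE mxE; apply: eq_bigr => j _.
by rewrite !mxE big_ord1 !mxE eqxx mulr1n.
Qed.

Lemma vhorner_monic A v P : P \is monic -> size P = n.+1 ->
  vhorner A v P = krylov A v *m (\col_i P`_i) + A ^+ n *m v.
Proof.
move=> Pmon szP; rewrite /vhorner szP big_ord_recr /=.
move/monicP: Pmon; rewrite /lead_coef szP /= => ->; rewrite mulmx1.
congr (_ + _); apply/colP => i; rewrite summxE mxE; apply: eq_bigr => j _.
by rewrite !mxE big_ord1 !mxE eqxx mulr1n.
Qed.

(* Only the last columns of the two sides can differ. *)
Lemma krylov_lcompanionP A v P : (0 < n)%N -> P \is monic -> size P = n.+1 ->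
  A *m krylov A v = krylov A v *m lcompanion n P <-> vhorner A v P = 0.
Proof.
move=> n_gt0 Pmon szP; rewrite vhorner_monic //.
have colA (j : 'I_n) : col j (A *m krylov A v) = A ^+ j.+1 *m v.
  by rewrite col_mulmx col_krylov exprS mulmxA.
have colC (j : 'I_n) : col j (krylov A v *m lcompanion n P) =
    if j.+1 == n then - (krylov A v *m \col_i P`_i) else A ^+ j.+1 *m v.
  rewrite col_mulmx; case: eqP => [jn|/eqP jn].
    rewrite -mulmxN; congr (_ *m _); apply/colP => i.
    by rewrite !mxE jn eqxx.
  have ltjn : (j.+1 < n)%N by rewrite ltn_neqAle jn ltn_ord.
  rewrite -(col_krylov A v (Ordinal ltjn)) [RHS]colE; congr (_ *m _).
  by apply/colP => i; rewrite !mxE (negPf jn) eqxx andbT.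
split=> [AK|P0].
  have ltn1 : (n.-1 < n)%N by rewrite ltn_predL.
  have := congr1 (col (Ordinal ltn1)) AK; rewrite colA colC /= prednK // eqxx.
  by move=> ->; rewrite addrN.
apply/col_matrixP => j; rewrite colA colC; case: eqP => // ->.
by apply/eqP; rewrite -addr_eq0 addrC P0.
Qed.

Lemma monic_generator_cyclic A v P : P \is monic -> size P = n.+1 ->
  cyclic_vector A v -> vhorner A v P = 0 ->
  monic_generator (right_annihilator A v) P.
Proof.
move=> Pmon szP cv P0; split=> //; rewrite eqEsubset; split; last first.
  by move=> _ [h _ <-]; apply: vhornerM_eq0.
move=> q; rewrite /right_annihilator /= -/(vhorner A v q).
(* Euclidean division by [P], run as an induction on a bound for [size q]. *)
have [m] := ubnP (size q); elim: m q => // m IHm q; rewrite ltnS => le_qm q0.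
case: (leqP (size q) n) => [le_qn|lt_nq].
  (* In degree below [n], the invertible Krylov matrix kills the coefficient column, so [q = 0]. *)
  exists 0 => //; rewrite mulr0; apply/polyP => i; rewrite coef0.
  case: (leqP n i) => [le_ni|lt_in].
    by rewrite nth_default ?(leq_trans le_qn).
  move: q0; rewrite vhorner_krylov // -(mulmx0 _ (krylov A v)).
  by move/(mx_invertible_mulmxI cv)/colP/(_ (Ordinal lt_in)); rewrite !mxE.
case: m IHm le_qm => [|m] IHm le_qm; first by have := leq_trans lt_nq le_qm.
have le_nm : (n <= m)%N by rewrite -ltnS (leq_trans lt_nq).
pose h : {poly F} := (- q`_m)%:P * 'X^(m - n).
have [|//|k _ Ek] := IHm (q + P * h).
- rewrite ltnS; apply/leq_sizeP => i le_mi.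
  rewrite coefD mulrA coefMXn coefMC ltnNge (leq_trans (leq_subr _ _) le_mi) /=.
  case: (ltngtP m i) le_mi => // [lt_mi|<-] _.
    rewrite (nth_default _ (leq_trans le_qm lt_mi)) add0r nth_default ?mul0r //.
    by rewrite szP subnBA // ltn_subRL ltn_add2r.
  move/monicP: Pmon; rewrite /lead_coef szP subKn //= => ->.
  by rewrite mul1r addrN.
- by rewrite vhornerD q0 add0r vhornerM_eq0.
by exists (k - h) => //; rewrite mulrBr Ek addrK.
Qed.

Lemma exists_annihilating A v : cyclic_vector A v ->
  exists P, [/\ P \is monic, size P = n.+1 & vhorner A v P = 0].
Proof.
rewrite /cyclic_vector -/(krylov A v).
(* The lower coefficients have to solve [krylov A v *m c = - (A ^+ n *m v)]. *)
move=> [B [KB _]]; pose c : 'cV[F]_n := - (B *m (A ^+ n *m v)).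
(* The index [n] lies outside ['I_n], so there [insub] fails and the default 1 becomes the leading
   coefficient. *)
pose P : {poly F} :=
  \poly_(i < n.+1) oapp (fun i : 'I_n => c i 0) 1 (insub i : option 'I_n).
have Pn : P`_n = 1 by rewrite coef_poly ltnSn insubN // ltnn.
have szP : size P = n.+1.
  by rewrite size_poly_eq // insubN ?ltnn ?oner_neq0.
have Pmon : P \is monic by rewrite monicE /lead_coef szP Pn.
exists P; split=> //; rewrite vhorner_monic //.
have -> : \col_i P`_i = c.
  by apply/colP => i; rewrite !mxE coef_poly ltnS ltnW // valK /= !mxE.
by rewrite mulmxN (mulmxA (krylov A v)) KB mul1mx addNr.
Qed.

Lemma vminpoly_eq A v P :
  monic_generator (right_annihilator A v) P -> vminpoly A v = P.
Proof.
move=> genP; apply: monic_generator_unique (genP).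
exact: (@xgetPex _ 0 [set Q | monic_generator (right_annihilator A v) Q]
  (ex_intro _ P genP)).
Qed.

Lemma vminpoly_krylov A v P : (0 < n)%N -> cyclic_vector A v ->
  P \is monic -> size P = n.+1 ->
  A *m krylov A v = krylov A v *m lcompanion n P -> vminpoly A v = P.
Proof.
move=> n_gt0 cv Pmon szP /(krylov_lcompanionP _ _ n_gt0 Pmon szP) P0.
exact/vminpoly_eq/monic_generator_cyclic.
Qed.

Lemma vminpoly_cyclic A v (P := vminpoly A v) : (0 < n)%N ->
  cyclic_vector A v ->
  [/\ P \is monic, size P = n.+1,
      monic_generator (right_annihilator A v) P &
      A *m krylov A v = krylov A v *m lcompanion n P].
Proof.
move=> n_gt0 cv; have [Q [Qmon szQ Q0]] := exists_annihilating cv.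
have genQ := monic_generator_cyclic Qmon szQ cv Q0.
rewrite /P (vminpoly_eq genQ); split=> //.
exact/krylov_lcompanionP.
Qed.

(** The companion matrix shifts each basis vector to the next one, so the Krylov vectors of the
    first are the whole standard basis in order. *)
Lemma krylov_lcompanion P (n_gt0 : (0 < n)%N) :
  krylov (lcompanion n P) (delta_mx (Ordinal n_gt0) 0) = 1%:M.
Proof.
apply/col_matrixP => -[j lt_jn]; rewrite col_krylov colE mul1mx /=.
elim: j lt_jn => [|j IHj] lt_jn.
  by rewrite expr0 mul1mx; congr (delta_mx _ _); apply: val_inj.
rewrite exprS -mulmxA (IHj (ltnW lt_jn)) -colE.
by apply/colP => i; rewrite !mxE /= (ltn_eqF lt_jn) eqxx andbT.
Qed.

End Krylov.

Theorem theorem4p4 (F : unitRingType) (hF : division_ring F)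
    (n : nat) (hn : (0 < n)%N)
    (p : {poly F}) (hp : p \is monic) (hpn : size p = n.+1) :
  let C : 'M[F]_n := lcompanion n p in
  let phi : 'cV[F]_n -> {poly F} := vminpoly C in
  [/\ forall v, cyclic_vector C v ->
        monic_generator (right_annihilator C v) (phi v),
      set_fun [set v | cyclic_vector C v] (similarity_class p) phi,
      set_surj [set v | cyclic_vector C v] (similarity_class p) phi &
      forall v v', cyclic_vector C v -> cyclic_vector C v' ->
        (phi v = phi v' <->
         exists T : 'M[F]_n,
           [/\ mx_invertible T, T *m C = C *m T & v' = T *m v])].
Proof.
move=> C phi; split.
- by move=> v /(vminpoly_cyclic hn)[].
- move=> v /= cv; have [Pmon szP _ CK] := vminpoly_cyclic hn cv.
  by split=> //; exists n; split=> //; exists (krylov C v).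
(* The dimension [m] hidden in [poly_similar] equals [n] because [size p = n.+1]. *)
- move=> g [gmon [m [szg]]]; rewrite hpn => -[mn]; rewrite -{m}mn in szg *.
  move=> [S invS SC]; pose e : 'cV[F]_n := delta_mx (Ordinal hn) 0.
  have KS : krylov C (S *m e) = S.
    by rewrite (krylov_mul _ SC) krylov_lcompanion mulmx1.
  have cSe : cyclic_vector C (S *m e).
    by rewrite /cyclic_vector -/(krylov C _) KS.
  by exists (S *m e) => //; apply: vminpoly_krylov; rewrite ?KS.
- move=> v v' cv cv'; have [Pmon szP _ CK] := vminpoly_cyclic hn cv.
  split=> [eq_phi|[T [_ TC v'E]]]; last first.
    apply/esym/vminpoly_krylov => //.
    (* The Krylov matrix of [v'] is [T *m krylov C v]; as [T] commutes with [C], it inherits the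
       companion equation of [phi v]. *)
    by rewrite v'E (krylov_mul _ TC) mulmxA -TC -!mulmxA CK.
  have [_ _ _ CK'] := vminpoly_cyclic hn cv'.
  rewrite -/(phi v) in CK; rewrite -/(phi v') -eq_phi in CK'.
  have [B [KB BK]] := cv; rewrite -/(krylov C v) in KB BK.
  exists (krylov C v' *m B); split.
  + by apply: mx_invertibleM => //; exists (krylov C v).
  (* Multiplying the companion equation by [B], the inverse of [krylov C v], on both sides reverses
     the intertwining. *)
  + have BC : B *m C = lcompanion n (phi v) *m B.
      by rewrite -[LHS]mulmx1 -KB -mulmxA (mulmxA C) CK !mulmxA BK mul1mx.
    by rewrite -mulmxA BC !mulmxA CK'.
  (* The first Krylov column is the vector itself, so [B] sends [v] to the first basis vector and
     [krylov C v'] sends that to [v']. *)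
  + have Ke w : krylov C w *m delta_mx (Ordinal hn) 0 = w.
      by rewrite -colE col_krylov expr0 mul1mx.
    by rewrite -(Ke v) -mulmxA (mulmxA B) BK mul1mx Ke.
Qed.
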